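(* Fix an integer $q \geq 3$. For each $f$, let $\Lambda_{f,q}$ be a uniformly random numerical semigroup of depth $q$ with Frobenius number $f$, and $m(\Lambda_{f,q})$ its multiplicity. Then for every $\varepsilon > 0$, \[\lim_{f \to \infty} \mathbb{P}\big(|f - (q-1)\, m(\Lambda_{f,q})| < \varepsilon f\big) = 1.\]
   Context: A numerical semigroup is a subset $\Lambda \subseteq \mathbb{N}_0$ containing $0$, closed under addition, with finite complement. Its multiplicity is $m(\Lambda) = \min(\Lambda\setminus\{0\})$, its conductor $c(\Lambda)$ is the least $c$ with $c + \mathbb{N}_0 \subseteq \Lambda$, its Frobenius number is $c(\Lambda)-1$, and its depth is $\lceil c(\Lambda)/m(\Lambda) \rceil$. *)

(* Defs.v *)
From HB Require Import structures.
From mathcomp Require Import all_boot all_order all_algebra.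
From mathcomp Require Import all_classical all_reals all_analysis.
Set Implicit Arguments. Unset Strict Implicit. Unset Printing Implicit Defensive.
Import Order.TTheory GRing.Theory Num.Theory.
Local Open Scope ring_scope.

Definition is_numerical_semigroup (L : nat -> Prop) : Prop :=
  L 0%N /\ (forall a b, L a -> L b -> L (a + b)%N) /\
  exists N, forall n, (N <= n)%N -> L n.

Definition is_conductor (L : nat -> Prop) (c : nat) : Prop :=
  (forall n, (c <= n)%N -> L n) /\
  (forall c', (forall n, (c' <= n)%N -> L n) -> (c <= c')%N).

Definition is_multiplicity (L : nat -> Prop) (m : nat) : Prop :=
  (0 < m)%N /\ L m /\ (forall k, (0 < k)%N -> (k < m)%N -> ~ L k).

Definition has_frobenius (L : nat -> Prop) (f : nat) : Prop :=
  is_conductor L f.+1.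

Definition has_depth (L : nat -> Prop) (q : nat) : Prop :=
  exists c m, is_conductor L c /\ is_multiplicity L m /\
              q = ((c + m - 1) %/ m)%N.

(* Every numerical semigroup with Frobenius number f is determined by its
   intersection with {0,...,f}; it contains every n > f.  We encode it by a
   subset A of 'I_f.+1. *)
Definition sg_of (f : nat) (A : {set 'I_f.+1}) : nat -> Prop :=
  fun n => (f < n)%N \/ exists i : 'I_f.+1, i \in A /\ nat_of_ord i = n.

Definition sample_space (q f : nat) : {set {set 'I_f.+1}} :=
  [set A : {set 'I_f.+1} | `[< is_numerical_semigroup (sg_of A) /\
                               has_frobenius (sg_of A) f /\
                               has_depth (sg_of A) q >]].

Definition good_event (R : realType) (q : nat) (eps : R) (f : nat) :
  {set {set 'I_f.+1}} :=
  [set A in sample_space q f | `[< exists m, is_multiplicity (sg_of A) m /\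
        `| (f%:R : R) - (q%:R - 1) * m%:R | < eps * f%:R >]].

Definition prob_good (R : realType) (q : nat) (eps : R) (f : nat) : R :=
  (#|good_event q eps f|)%:R / (#|sample_space q f|)%:R.

(* Main.v *)
Require Import Defs.
From HB Require Import structures.
From mathcomp Require Import all_boot all_order all_algebra.
From mathcomp Require Import all_classical all_reals all_analysis.
From mathcomp Require Import zify lra.
Import Order.TTheory GRing.Theory Num.Theory numFieldNormedType.Exports.
Set Implicit Arguments. Unset Strict Implicit. Unset Printing Implicit Defensive.

(* Write f = (q - 1) m + r with 0 <= r < m, and b(h) = floor((h + 2)^2 / 4), the
   largest number of pairs in a product X x Y of sets of naturals <= h with
   x + y >= h for all x in X and y in Y.  A semigroup of multiplicity m is given
   by its Kunz coordinates k_i, the least k with k m + i in the semigroup.  Every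
   gap g forces k_i + k_j >= floor((g - i) / m) + 1 whenever i + j = g mod m.

   Upper bound.  Up to few exceptional coordinates, there is a window of length
   o(f) containing many gaps, with few gaps above it; these gaps define a regular
   graph on Z/m of large degree.  A greedily chosen small set of coordinates
   (a fingerprint, as in the container method) then confines almost every pair
   of adjacent coordinates to a product set as above, so that at most
   (b(q)^r b(q-1)^(m-r))^(1/2) exp(o(f)) semigroups have multiplicity m.

   Lower bound.  For r bounded, letting k_i range over [q/2, q-1] or
   [(q-1)/2, q-1] according to whether 2 i <= m + r gives b(q-1)^(m/2 - O(1))
   semigroups with m = f/(q-1) + O(1).

   Since b(q)^(q-1) < b(q-1)^q for q >= 3, the multiplicities m with
   r >= eps f contribute an exponentially small proportion. *)

(** * Containers for homomorphisms into threshold graphs *)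

Definition biclique (h : nat) : nat := (h.+2)./2 * (h.+3)./2.

Lemma mul_le_halves (x y : nat) : x * y <= (x + y)./2 * (x + y).+1./2.
Proof.
wlog le_xy : x y / x <= y.
  by case/orP: (leq_total x y) => le H; last rewrite mulnC addnC; apply: H.
have := odd_double_half (x + y); have := odd_double_half (x + y).+1.
move: (x + y)./2 (x + y).+1./2 => u v /=.
case: (odd (x + y)) => /=; nia.
Qed.

Lemma biclique_ge (h x : nat) : x <= h -> (h - x).+1 * x.+1 <= biclique h.
Proof.
move=> le_xh; have -> : biclique h = ((h - x).+1 + x.+1)./2 * ((h - x).+1 + x.+1).+1./2.
  by rewrite /biclique; have -> : (h - x).+1 + x.+1 = h.+2 by lia.
exact: mul_le_halves.
Qed.

Lemma biclique_gt0 (h : nat) : 0 < biclique h.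
Proof. by rewrite muln_gt0. Qed.

Lemma leq_biclique (h h' : nat) : h <= h' -> biclique h <= biclique h'.
Proof. by move=> le; rewrite leq_mul // half_leq // !ltnS. Qed.

Lemma leq_expn_base (m n j : nat) : m <= n -> m ^ j <= n ^ j.
Proof. by case: j => // j; rewrite leq_exp2r. Qed.

Lemma leq_card_bigcup (T J : finType) (F : J -> {set T}) :
  #|\bigcup_j F j| <= \sum_j #|F j|.
Proof.
elim/big_rec2: _ => [|j n A _ le]; first by rewrite cards0.
by rewrite (leq_trans (leq_card_setU _ _)) // leq_add2l.
Qed.

Section Container.

(** In the application [V] is the set of residues modulo m and [I] indexes gaps g in one window.
    Each [sigma a] is a matching, possibly with fixed points, whose edges carry the thresholds
    [hh a]; [h] is a common majorant of these thresholds. *)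
Variables (V I : finType) (Q e : nat).
Variables (sigma : I -> V -> V) (hh : I -> V -> nat) (h : V -> nat).

Hypothesis sigmaK : forall a, involutive (sigma a).
Hypothesis sigma_inj : forall v, injective (sigma^~ v).
Hypothesis hh_sigma : forall a v, hh a (sigma a v) = hh a v.
Hypothesis hh_le : forall a v, hh a v <= h v.
Hypothesis h_le : forall v, h v <= Q.

Implicit Types (phi : V -> option nat) (k : V -> nat) (S : {set V}).

(** [phi] is a partial labelling. A neighbour of [w] with known label x forces at least [hh a w - x]
    at [w] in any admissible extension; a neighbour without label forces nothing, hence the 0. *)
Definition lower_bound phi (w : V) : nat :=
  \max_(a : I) (if phi (sigma a w) is Some x then hh a w - x else 0).

Definition defect phi (v : V) (x : nat) : nat :=
  #|[set a | lower_bound phi (sigma a v) + x < hh a v]|.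

(** The defect of x counts the edges at [v] that fail when [v] gets x and every neighbour only its
    forced minimum. If no x below [h v] has small defect, [find] returns [h v], where the defect
    vanishes because [hh a v <= h v]. *)
Definition defect_bound phi (v : V) : nat :=
  find (fun x => defect phi v x <= e) (iota 0 (h v)).

Definition restriction k S : V -> option nat :=
  fun v => if v \in S then Some (k v) else None.

Definition admissible k := forall a v, hh a v <= k v + k (sigma a v).

Lemma lower_bound_le_Q phi w : lower_bound phi w <= Q.
Proof.
apply/bigmax_leqP => a _; case: (phi _) => // x.
by rewrite (leq_trans (leq_subr _ _)) // (leq_trans (hh_le _ _)).
Qed.

Lemma lower_bound_le k S w : admissible k -> lower_bound (restriction k S) w <= k w.
Proof.
move=> kP; apply/bigmax_leqP => a _; rewrite /restriction.
by case: ifP => // _; rewrite leq_subLR addnC.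
Qed.

Lemma lower_bound_subset k S S' w : S \subset S' ->
  lower_bound (restriction k S) w <= lower_bound (restriction k S') w.
Proof.
move=> sS; apply/bigmax_leqP => a _; rewrite {1}/restriction; case: ifP => // aS.
apply: leq_trans (leq_bigmax a); rewrite /restriction.
by rewrite (fintype.subsetP sS).
Qed.

Lemma lower_bound_ge k S a v : v \in S ->
  hh a v - k v <= lower_bound (restriction k S) (sigma a v).
Proof.
move=> vS; apply: leq_trans (leq_bigmax a).
by rewrite sigmaK /restriction vS hh_sigma.
Qed.

Lemma defect_subset k S S' v x : S \subset S' ->
  defect (restriction k S') v x <= defect (restriction k S) v x.
Proof.
move=> sS; apply/subset_leq_card/fintype.subsetP => a; rewrite !inE.
by apply: leq_ltn_trans; rewrite leq_add2r lower_bound_subset.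
Qed.

Lemma defect_in k S v : v \in S -> defect (restriction k S) v (k v) = 0.
Proof.
move=> vS; apply/eqP; rewrite cards_eq0 -finset.subset0; apply/fintype.subsetP => a.
by rewrite !inE ltnNge addnC -leq_subLR lower_bound_ge.
Qed.

(* Adding v to S raises the lower bound at sigma a v for every a in the defect
   of v, hence a set S maximising sum(lower bounds) - e |S| has no vertex of
   defect larger than e. *)
Lemma exists_fingerprint k :
  exists S, e * #|S| <= Q * #|V| /\
            forall v, defect (restriction k S) v (k v) <= e.
Proof.
(* The shift by e |V| keeps the maximised quantity within the natural numbers. *)
pose w S := \sum_v lower_bound (restriction k S) v + e * (#|V| - #|S|).
have [S maxS] : exists S, forall S', w S' <= w S.
  by case: (@arg_maxnP _ (finset.set0 : {set V}) predT w isT) => S _ maxS; exists S => S'; apply: maxS.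
exists S; split.
  have := maxS finset.set0; rewrite /w /= cards0 subn0.
  have : \sum_v lower_bound (restriction k S) v <= Q * #|V|.
    rewrite mulnC -sum_nat_const; apply: leq_sum => v _; exact: lower_bound_le_Q.
  have le : e * #|S| <= e * #|V| by rewrite leq_mul2l max_card orbT.
  rewrite mulnBr; move: le.
  move: (e * #|S|) (e * #|V|) (Q * #|V|) => x y z.
  by move: (\sum_v _) (\sum_v _) => X Y; lia.
move=> v; have [vS|vS] := boolP (v \in S); first by rewrite defect_in.
have := maxS (v |: S); rewrite /w /= cardsU1 vS add1n.
have ltS : #|S| < #|V|.
  by rewrite -cardsT; apply/proper_card; rewrite finset.properT; apply: contraNneq vS => ->.
have -> : #|V| - #|S| = (#|V| - #|S|.+1).+1 by lia.
rewrite mulnS.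
suff : \sum_u lower_bound (restriction k S) u + defect (restriction k S) v (k v)
    <= \sum_u lower_bound (restriction k (v |: S)) u.
  move: (\sum_u _) (\sum_u _) (defect _ _ _) (e * _) => X Y x z; lia.
pose B := [set a | lower_bound (restriction k S) (sigma a v) + k v < hh a v].
(* By [sigma_inj] distinct indices reach distinct vertices, so the defect is the number of vertices
   whose lower bound rises. *)
have -> : defect (restriction k S) v (k v) = \sum_u (u \in [set sigma a v | a in B]).
  by rewrite /defect -/B -(card_imset _ (@sigma_inj v)) -sum1_card big_mkcond.
rewrite -big_split /=; apply: leq_sum => u _.
case: imsetP => [[a aB ->]|_]; last by rewrite addn0 lower_bound_subset ?finset.subsetUr.
have := @lower_bound_ge k (v |: S) a v (finset.setU11 _ _).
by move: aB; rewrite inE; lia.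
Qed.

Lemma defect_bound_le_h phi v : defect_bound phi v <= h v.
Proof. by rewrite (leq_trans (find_size _ _)) // size_iota. Qed.

Lemma defect_bound_le phi v x : defect phi v x <= e -> defect_bound phi v <= x.
Proof.
move=> le_e; rewrite leqNgt; apply/negP => lt_x.
have lt_xh := leq_trans lt_x (defect_bound_le_h phi v).
by have := before_find 0 lt_x; rewrite nth_iota // le_e.
Qed.

Lemma defect_defect_bound phi v : defect phi v (defect_bound phi v) <= e.
Proof.
have [hs|hs] := boolP (has (fun x => defect phi v x <= e) (iota 0 (h v))).
  have := nth_find 0 hs; rewrite nth_iota //.
  by move: hs; rewrite has_find size_iota.
have -> : defect_bound phi v = h v by rewrite /defect_bound hasNfind // size_iota.
rewrite [X in X <= _](_ : _ = 0) //; apply/eqP; rewrite cards_eq0 -finset.subset0.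
by apply/fintype.subsetP => a; rewrite !inE ltnNge (leq_trans (hh_le a v)) ?leq_addl.
Qed.

(** The labels that the container of [phi] allows at [v]: the known one, or an interval cut off
    below by both bounds. *)
Definition slice phi (v : V) : pred 'I_Q.+1 :=
  fun y => if phi v is Some x then nat_of_ord y == x
           else (maxn (defect_bound phi v) (lower_bound phi v) <= y) && (y <= h v).

Lemma card_interval_ord (n lo hi : nat) :
  #|[pred y : 'I_n | (lo <= y) && (y <= hi)]| <= (hi - lo).+1.
Proof.
rewrite cardE -(size_map (@nat_of_ord n)) -(size_iota lo (hi - lo).+1).
apply: uniq_leq_size; first by rewrite (map_inj_uniq (@ord_inj n)) enum_uniq.
move=> x /mapP[y]; rewrite mem_enum inE mem_iota => /andP[l u] ->.
by rewrite l /=; lia.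
Qed.

(** The interval is no longer than either cut-off permits. Keeping one factor for each cut-off lets
    the first at [v] be paired later with the second at a neighbour of [v]. *)
Lemma card_slice phi v :
  #|slice phi v| ^ 2 <= (h v - defect_bound phi v).+1 * (h v - lower_bound phi v).+1.
Proof.
rewrite -mulnn /slice; case: (phi v) => [x|].
  have le1 : #|[pred y : 'I_Q.+1 | nat_of_ord y == x]| <= (x - x).+1.
    apply: leq_trans (card_interval_ord Q.+1 x x); apply: subset_leq_card.
    by apply/fintype.subsetP => y; rewrite !inE => /eqP ->; rewrite leqnn.
  by apply: leq_trans (leq_mul le1 le1) _; rewrite subnn.
have le := card_interval_ord Q.+1 (maxn (defect_bound phi v) (lower_bound phi v)) (h v).
apply: leq_trans (leq_mul le le) _.
by rewrite leq_mul // ltnS leq_sub2l // ?leq_maxl ?leq_maxr.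
Qed.

Variable Delta : nat.
Hypothesis hh_mismatch : forall a, #|[set v | hh a v != h v]| <= Delta.

(** On an edge from v to w = [sigma a v] that is not bad, the two cut-offs sum to at least the
    common threshold [h v] = [h w], so the two factors multiply to at most [biclique (h v)]. A bad
    edge costs at most (Q + 1)^2 more, and bad edges are few. *)
Lemma card_slices phi :
  (\prod_v #|slice phi v|) ^ (2 * #|I|) <=
  (\prod_v biclique (h v)) ^ #|I| * Q.+1 ^ (2 * (e * #|V| + 2 * Delta * #|I|)).
Proof.
pose c v := (h v - defect_bound phi v).+1; pose rho v := (h v - lower_bound phi v).+1.
pose bad a v := [|| lower_bound phi (sigma a v) + defect_bound phi v < hh a v,
  hh a v != h v | hh a (sigma a v) != h (sigma a v)].
have step1 : (\prod_v #|slice phi v|) ^ 2 <= (\prod_v c v) * (\prod_v rho v).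
  rewrite -mulnn -!big_split /=; apply: leq_prod => v _.
  by rewrite mulnn card_slice.
have step2 a v : c v * rho (sigma a v) <= biclique (h v) * Q.+1 ^ (2 * bad a v).
  have worst : c v * rho (sigma a v) <= biclique (h v) * Q.+1 ^ 2.
    apply: leq_trans (leq_pmull _ (biclique_gt0 _)); rewrite -mulnn leq_mul // ltnS;
      by apply: leq_trans (leq_subr _ _) (h_le _).
  rewrite /bad; case: ltnP => [_|lb] /=; first by rewrite muln1.
  case: eqVneq => [ev|_] /=; last by rewrite muln1.
  case: eqVneq => [ew|_] /=; last by rewrite muln1.
  rewrite muln0 expn0 muln1; have le := defect_bound_le_h phi v.
  apply: leq_trans (biclique_ge le); rewrite leq_mul // /rho -ew hh_sigma; lia.
(* At a fixed vertex at most [e] edges violate the cut-offs, by the choice of [defect_bound]; for a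
   fixed [a], each end of an edge mismatches [h] at most [Delta] times. *)
have step3 : \sum_a \sum_v bad a v <= e * #|V| + 2 * Delta * #|I|.
  have -> : e * #|V| + 2 * Delta * #|I| = \sum_(v : V) e + \sum_(a : I) (Delta + Delta).
    by congr (_ + _); rewrite sum_nat_const mulnC // addnn -mul2n.
  pose b1 a v := lower_bound phi (sigma a v) + defect_bound phi v < hh a v.
  apply: (@leq_trans (\sum_a \sum_v b1 a v +
      \sum_a (\sum_v (hh a v != h v) + \sum_v (hh a (sigma a v) != h (sigma a v))))).
    rewrite -big_split /=; apply: leq_sum => a _; rewrite -!big_split /=.
    apply: leq_sum => v _; rewrite /bad -/(b1 a v).
    by case: (b1 a v); case: (hh a v != h v); case: (_ != _).
  apply: leq_add.
    rewrite exchange_big /=; apply: leq_sum => v _.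
    apply: leq_trans (defect_defect_bound phi v).
    by rewrite /defect -sum1dep_card [X in _ <= X]big_mkcond leq_sum.
  apply: leq_sum => a _.
  have H : \sum_v (hh a v != h v) <= Delta.
    apply: leq_trans (hh_mismatch a).
    by rewrite -sum1dep_card [X in _ <= X]big_mkcond leq_sum.
  by rewrite leq_add //; move: H; rewrite (reindex_inj (can_inj (sigmaK a))).
rewrite expnM (leq_trans (leq_expn_base _ step1)) //.
(* One copy of the product for each [a]; in that copy the second factors are permuted by [sigma a],
   so that factors meet along edges. *)
have -> : (\prod_v c v * \prod_v rho v) ^ #|I| = \prod_a \prod_v (c v * rho (sigma a v)).
  rewrite -prod_nat_const; apply: eq_bigr => a _; rewrite [RHS]big_split /=.
  by congr (_ * _); rewrite (reindex_inj (can_inj (sigmaK a))).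
apply: (@leq_trans (\prod_a \prod_v (biclique (h v) * Q.+1 ^ (2 * bad a v)))).
  by apply: leq_prod => a _; apply: leq_prod => v _; apply: step2.
rewrite (eq_bigr (fun a => \prod_v biclique (h v) * Q.+1 ^ (2 * \sum_v bad a v))); last first.
  by move=> a _; rewrite big_split /= -expn_sum big_distrr.
by rewrite big_split /= prod_nat_const -expn_sum -big_distrr leq_mul // leq_pexp2l // leq_mul2l.
Qed.

Lemma card_family_slice phi : #|family (slice phi)| = \prod_v #|slice phi v|.
Proof.
by rewrite card_family -big_enum foldrE big_map.
Qed.

Variables (s : nat) (v0 : V).

(** A code is an arbitrary list of [s] vertex-label pairs. It may repeat vertices or contradict
    itself, so codes are counted as plain functions and [pick] settles conflicts. *)
Definition decode (t : {ffun 'I_s -> V * 'I_Q.+1}) : V -> option nat :=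
  fun v => omap (fun j => nat_of_ord (t j).2) [pick j | (t j).1 == v].

(** The code lists the fingerprint together with the exceptional set [E] where [k] exceeds [h].
    Revealing more than the fingerprint is harmless, since it only lowers defects. *)
Lemma exists_code (k : {ffun V -> 'I_Q.+1}) (E : {set V}) (n : nat) :
  admissible (fun v => nat_of_ord (k v)) -> (forall v, v \notin E -> k v <= h v) ->
  #|E| <= n -> 0 < e -> Q * #|V| %/ e + n <= s ->
  exists t, k \in family (slice (decode t)).
Proof.
move=> kP kE En e_gt0 les.
have [S [cS dS]] := exists_fingerprint (fun v => nat_of_ord (k v)).
have SEs : #|S :|: E| <= s.
  apply: leq_trans les; apply: leq_trans (leq_card_setU _ _) _.
  by rewrite leq_add // leq_divRL // mulnC.
(* Past the end of the enumeration [nth] yields [v0], which is recorded with its true label; the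
   revealed set [T] can therefore be larger than [S :|: E]. *)
pose v_ (j : 'I_s) := nth v0 (enum (S :|: E)) j.
pose t := [ffun j : 'I_s => (v_ j, k (v_ j))].
pose T := [set v_ j | j : 'I_s].
have sT : S :|: E \subset T.
  apply/fintype.subsetP => v vSE; have lts : index v (enum (S :|: E)) < s.
    by apply: leq_trans SEs; rewrite cardE index_mem mem_enum.
  by apply/imsetP; exists (Ordinal lts); rewrite // /v_ nth_index ?mem_enum.
have dec v : decode t v = restriction (fun v => nat_of_ord (k v)) T v.
  rewrite /decode /restriction; case: pickP => [j|no] /=.
    by rewrite ffunE /= => /eqP <-; rewrite imset_f.
  by case: imsetP => // -[j _ def]; have := no j; rewrite ffunE def eqxx.
have lb v : lower_bound (decode t) v =
    lower_bound (restriction (fun v => nat_of_ord (k v)) T) v.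
  by apply: eq_bigr => a _; rewrite dec.
exists t; apply/familyP => v; rewrite unfold_in /slice dec /restriction.
case: ifP => [_|vT]; first exact: eqxx.
have vSE : v \notin S :|: E by apply: contraFN vT; apply: (fintype.subsetP sT).
rewrite kE ?andbT; last by apply: contra vSE; rewrite inE orbC => ->.
rewrite geq_max lb lower_bound_le // andbT defect_bound_le //.
apply: leq_trans (dS v).
have -> : defect (decode t) v (k v) =
    defect (restriction (fun v => nat_of_ord (k v)) T) v (k v).
  by apply: eq_card => a; rewrite !inE lb.
by apply: defect_subset; apply: fintype.subset_trans sT; apply: finset.subsetUl.
Qed.

(** The family is covered by the containers of all codes, hence has at most (number of codes) times
    (largest container) members. *)
Lemma card_admissible_le (K : {set {ffun V -> 'I_Q.+1}}) (n N : nat) :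
  0 < e -> #|I| = N * e -> Q * #|V| %/ e + n <= s ->
  (forall k : {ffun V -> 'I_Q.+1}, k \in K -> admissible (fun v => nat_of_ord (k v)) /\
     exists2 E : {set V}, #|E| <= n & forall v, v \notin E -> k v <= h v) ->
  #|K| ^ (2 * N) <= (#|V| * Q.+1) ^ (s * (2 * N)) *
    ((\prod_v biclique (h v)) ^ N * Q.+1 ^ (2 * (#|V| + 2 * Delta * N))).
Proof.
move=> e_gt0 cI les KP.
(* Raising to the power [e] turns the exponent 2 N into 2 |I|, the one in [card_slices]. *)
rewrite -(leq_exp2r _ _ e_gt0) !expnMn -!expnM.
have -> : 2 * N * e = 2 * #|I| by rewrite cI mulnA.
have -> : s * (2 * N) * e = s * (2 * #|I|) by rewrite cI -!mulnA.
have -> : 2 * (#|V| + 2 * Delta * N) * e = 2 * (e * #|V| + 2 * Delta * #|I|).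
  by rewrite cI; lia.
rewrite -cI.
have sub : K \subset \bigcup_(t : {ffun 'I_s -> V * 'I_Q.+1})
    [set k in family (slice (decode t))].
  apply/fintype.subsetP => k kK; have [ka [E En kE]] := KP k kK.
  have [t tP] := exists_code ka kE En e_gt0 les.
  by apply/finset.bigcupP; exists t; rewrite // inE.
pose F t := #|family (slice (decode t))|.
case: (@arg_maxnP _ [ffun=> (v0, ord0)] predT F isT) => t0 _ maxt0.
have cK : #|K| <= (#|V| * Q.+1) ^ s * F t0.
  apply: leq_trans (subset_leq_card sub) _.
  apply: leq_trans (leq_card_bigcup _) _.
  apply: (@leq_trans (\sum_(t : {ffun 'I_s -> V * 'I_Q.+1}) F t0)).
    by apply: leq_sum => t _; rewrite cardsE; apply: maxt0.
  by rewrite sum_nat_const card_ffun card_prod !card_ord.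
apply: leq_trans (leq_expn_base _ cK) _.
rewrite expnMn -expnM leq_mul // ?expnMn //.
have -> : F t0 = \prod_v #|slice (decode t0) v| by apply: card_family_slice.
exact: card_slices.
Qed.

End Container.

(** * Kunz coordinates and windows of gaps *)

(* Number of x <= g with x = i mod m, for i < m. *)
Definition level (m g i : nat) : nat := (g + m - i) %/ m.

Lemma level_split (m g : nat) (i : 'I_m) :
  g + m = level m g i * m + (g + m - i) %% m + i.
Proof. by rewrite -divn_eq subnK // (leq_trans (ltnW (ltn_ord i))) ?leq_addl. Qed.

Lemma leq_level (m g g' i : nat) : g <= g' -> level m g i <= level m g' i.
Proof. by move=> le; rewrite leq_div2r // leq_sub2r // leq_add2r. Qed.

Lemma level_le (m q g i : nat) : g < q * m -> level m g i <= q.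
Proof.
move=> lt; have m_gt0 : 0 < m by case: m lt => //; rewrite muln0.
by rewrite -ltnS ltn_divLR // mulSn; lia.
Qed.

Section Reflection.

Variables (m : nat) (m_gt0 : 0 < m).

Definition reflect_mod (g : nat) (i : 'I_m) : 'I_m :=
  Ordinal (ltn_pmod (g + m - i) m_gt0).

Lemma reflect_mod_sub (g : nat) (i : 'I_m) :
  g + m - reflect_mod g i = level m g i * m + i.
Proof. by rewrite {1}(level_split g i) /=; lia. Qed.

Lemma reflect_modK (g : nat) : involutive (reflect_mod g).
Proof.
by move=> i; apply: val_inj; rewrite /= reflect_mod_sub modnMDl modn_small.
Qed.

Lemma level_reflect_mod (g : nat) (i : 'I_m) :
  level m g (reflect_mod g i) = level m g i.
Proof. by rewrite {1}/level reflect_mod_sub divnMDl // divn_small // addn0. Qed.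

(** Equal reflections make g and g' congruent modulo m, and both lie among the [D <= m] consecutive
    integers ending at [c]. *)
Lemma reflect_mod_inj (D g g' c : nat) (i : 'I_m) : D <= m ->
  g <= c < g + D -> g' <= c < g' + D -> reflect_mod g i = reflect_mod g' i -> g = g'.
Proof.
move=> leD hg hg' /(congr1 val) /= eq_mod.
have := level_split g i; have := level_split g' i; rewrite eq_mod.
move: (level m g i) (level m g' i) ((g' + m - i) %% m) => x y z e1 e2.
have [lt|lt|xy] := ltngtP x y; last by move: e1 e2; rewrite xy; lia.
  have : x.+1 * m <= y * m by rewrite leq_mul2r lt orbT.
  by rewrite mulSn; lia.
have : y.+1 * m <= x * m by rewrite leq_mul2r lt orbT.
by rewrite mulSn; lia.
Qed.

Lemma card_set_inj_iota (P : {set 'I_m}) (F : 'I_m -> nat) (a n : nat) :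
  (forall i, F i %% m = i) -> (forall i, i \in P -> a <= F i < a + n) -> #|P| <= n.
Proof.
move=> Fm FP; rewrite cardE -(size_map F) -(size_iota a n).
apply: uniq_leq_size; last first.
  by move=> x /mapP[i]; rewrite mem_enum mem_iota => /FP + ->.
rewrite map_inj_uniq ?enum_uniq // => i j eqF; apply: val_inj => /=.
by rewrite -Fm eqF Fm.
Qed.

(** The levels of [i] differ only if its class has a member in (g, c], an interval with fewer than D
    integers. [F i - m] is the largest such member. *)
Lemma card_level_mismatch (g c D : nat) : g <= c < g + D ->
  #|[set i : 'I_m | level m g i != level m c i]| <= D.
Proof.
move=> /andP[le_gc lt_c]; pose F (i : 'I_m) := level m c i * m + i.
apply: leq_trans (_ : _ <= c - g) _; last by lia.
apply: (@card_set_inj_iota _ F (g + m).+1) => i; first by rewrite modnMDl modn_small.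
rewrite inE /F => ne; have lt : level m g i < level m c i.
  by rewrite ltn_neqAle ne leq_level.
have := level_split c i; have := level_split g i.
have := ltn_pmod (g + m - i) m_gt0.
have : (level m g i).+1 * m <= level m c i * m by rewrite leq_mul2r lt orbT.
rewrite mulSn; move: (level m g i * m) (level m c i * m) => x y.
move: ((g + m - i) %% m) ((c + m - i) %% m) => z w; lia.
Qed.

End Reflection.

Section Kunz.

Variables (L : pred nat) (f m q : nat).

Record semigroup_spec : Prop := SemigroupSpec {
  spec_add : forall x y, L x -> L y -> L (x + y);
  spec_zero : L 0;
  spec_gt0 : 0 < m;
  spec_mult : L m;
  spec_lt_mult : forall x, 0 < x < m -> ~~ L x;
  spec_gt_frob : forall x, f < x -> L x;
  spec_frob_lt : f < q * m;
  spec_mult_le : m <= f }.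

Hypothesis LP : semigroup_spec.

(** The search can stop at [q]: this default is a valid value because q m + i > f. *)
Definition kunz (i : nat) : nat := find (fun n => L (n * m + i)) (iota 0 q).

Lemma kunz_le i : kunz i <= q.
Proof. by rewrite (leq_trans (find_size _ _)) // size_iota. Qed.

Lemma kunzE n i : L (n * m + i) = (kunz i <= n).
Proof.
have stepL a b : L (a * m + i) -> L ((b + a) * m + i).
  move=> La; elim: b => // b IH; rewrite addSn mulSn -addnA.
  by apply: (spec_add LP) IH; apply: spec_mult LP.
have Lk : L (kunz i * m + i).
  have [hs|hs] := boolP (has (fun n => L (n * m + i)) (iota 0 q)).
    have := nth_find 0 hs; rewrite nth_iota //.
    by move: hs; rewrite has_find size_iota.
  have -> : kunz i = q by rewrite /kunz hasNfind // size_iota.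
  by apply: (spec_gt_frob LP); rewrite (leq_trans (spec_frob_lt LP)) ?leq_addr.
apply/idP/idP => [Ln|le]; last by rewrite -(subnK le) stepL.
rewrite leqNgt; apply/negP => lt.
have := before_find 0 lt; rewrite nth_iota ?Ln //.
exact: leq_trans lt (kunz_le i).
Qed.

(** With j the reflection of i, g = (level - 1) m + i + j. If the two coordinates summed to at most
    level - 1, this would split g into an element of the class of i and one of the class of j. *)
Lemma kunz_add_ge (m_gt0 : 0 < m) g (i : 'I_m) : ~~ L g ->
  level m g i <= kunz i + kunz (reflect_mod m_gt0 g i).
Proof.
move=> gL; rewrite leqNgt; apply/negP => lt; case/negP: gL.
have eq_g := level_split g i; move: lt eq_g; rewrite -[_ %% _]/(val (reflect_mod m_gt0 g i)).
move: (reflect_mod _ _ _) => j; case: (level m g i) => // n; rewrite ltnS => le.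
rewrite mulSn => eq_g.
have -> : g = (kunz i * m + i) + ((n - kunz i) * m + j).
  have le' : kunz i * m <= n * m by rewrite leq_mul2r (leq_trans (leq_addr _ _) le) orbT.
  rewrite mulnBl /=; move: eq_g => /=; lia.
by apply: (spec_add LP); rewrite kunzE //; lia.
Qed.

Definition gaps : {set 'I_f.+1} := [set g | ~~ L (nat_of_ord g)].

Lemma card_gaps_ge : m.-1 <= #|gaps|.
Proof.
have mf := spec_mult_le LP; have m0 := spec_gt0 LP.
have lt (i : 'I_m.-1) : i.+1 < f.+1 by have := ltn_ord i; lia.
rewrite -[m.-1]card_ord -(card_codom (f := fun i => Ordinal (lt i))); last first.
  by move=> i j /(congr1 val) [] /val_inj.
apply: subset_leq_card; apply/fintype.subsetP => _ /codomP[i ->]; rewrite inE /=.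
by apply: (spec_lt_mult LP); have := ltn_ord i; lia.
Qed.

(** Such a coordinate produces the gap (k_i - 1) m + i above [c], and this gap remembers i as its
    residue. *)
Lemma card_kunz_gt c :
  #|[set i : 'I_m | level m c i < kunz i]| <= #|[set g in gaps | c < g]|.
Proof.
have m_gt0 := spec_gt0 LP.
have gapP (i : 'I_m) : level m c i < kunz i ->
    ~~ L ((kunz i).-1 * m + i) /\ c < (kunz i).-1 * m + i.
  move=> lt; split; first by rewrite kunzE -ltnNge prednK // (leq_ltn_trans _ lt).
  have := level_split c i; have := ltn_pmod (c + m - i) m_gt0.
  have : (level m c i).+1 * m <= kunz i * m by rewrite leq_mul2r lt orbT.
  rewrite -subn1 mulnBl mul1n mulSn.
  move: (level m c i * m) (kunz i * m) => x y.
  move: ((c + m - i) %% m) => z; lia.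
have gap_le (i : 'I_m) : level m c i < kunz i -> (kunz i).-1 * m + i < f.+1.
  move=> /gapP[gL _]; rewrite ltnS leqNgt; apply: contra gL.
  exact: (spec_gt_frob LP).
pose F (i : 'I_m) : 'I_f.+1 := inord ((kunz i).-1 * m + i).
rewrite -(card_in_imset (f := F)).
  apply: subset_leq_card; apply/fintype.subsetP => g /imsetP[i]; rewrite inE => ki ->.
  by have [gL lt] := gapP i ki; rewrite !inE inordK ?gap_le // gL.
move=> i j; rewrite !inE => ki kj /(congr1 val); rewrite /= !inordK ?gap_le // => eqF.
by apply: val_inj => /=; have /(congr1 (modn^~ m)) := eqF; rewrite !modnMDl !modn_small.
Qed.

(** Scan windows of length D downwards from f and stop at the first with at least d gaps; the
    windows passed before contain few gaps in total. If none of the M windows qualified, there would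
    be at most M d < m - 1 gaps, but 1, ..., m - 1 are gaps. *)
Lemma exists_window (M d D : nat) : f <= M * D -> M * d < m.-1 ->
  exists c : 'I_f.+1, #|[set g in gaps | c < g]| <= M * d /\
    d <= #|[set g in gaps | g <= c < g + D]|.
Proof.
move=> fMD ltd.
suff /(_ M (leqnn M)) [//|le] : forall t, t <= M ->
    (exists c : 'I_f.+1, #|[set g in gaps | c < g]| <= M * d /\
      d <= #|[set g in gaps | g <= c < g + D]|) \/
    #|[set g in gaps | f - t * D < g]| <= t * d.
  suff le' : #|gaps| <= M * d.
    by have := leq_trans ltd (leq_trans card_gaps_ge le'); rewrite ltnn.
  apply: leq_trans le; apply/subset_leq_card/fintype.subsetP => g; rewrite !inE => gL.
  (* The windows reach down to 0 exclusively, and 0 is not a gap. *)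
  rewrite gL (eqP (_ : f - M * D == 0)) ?subn_eq0 //= lt0n.
  by apply: contraNneq gL => ->; exact: spec_zero LP.
elim=> [_|t IH lt_tM].
  right; rewrite mul0n subn0 leqn0 cards_eq0 -finset.subset0; apply/fintype.subsetP => g.
  by rewrite !inE => /andP[_]; rewrite ltnNge -ltnS ltn_ord.
have [|small] := IH (ltnW lt_tM); first by left.
have c_lt : f - t * D < f.+1 by rewrite ltnS leq_subr.
have [big|few] := leqP d #|[set g in gaps | g <= Ordinal c_lt < g + D]|.
  left; exists (Ordinal c_lt); split => //.
  by rewrite (leq_trans small) // leq_mul2r ltnW ?orbT.
right; rewrite mulSn (leq_trans _ (leq_add (ltnW few) small)) //.
apply: leq_trans (leq_card_setU _ _); apply/subset_leq_card/fintype.subsetP => g.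
by rewrite !inE /= => /andP[-> /=]; lia.
Qed.

End Kunz.

(** * Upper bound for a fixed multiplicity, in Kunz coordinates *)

Section Count.

Variables (f m q N e M D s : nat).
Hypotheses (m_gt0 : 0 < m) (e_gt0 : 0 < e) (N_gt0 : 0 < N).
Hypotheses (f_lt : f < q * m) (fMD : f <= M * D) (leDm : D <= m).
Hypotheses (ltMd : M * (N * e) < m.-1) (les : q * m %/ e + M * (N * e) <= s).

Lemma card_kunz_le (K : {set {ffun 'I_m -> 'I_q.+1}}) :
  (forall k, k \in K -> exists2 L, semigroup_spec L f m q &
     forall i, k i = kunz L m q i :> nat) ->
  #|K| ^ (2 * N) <= (f.+1 ^ (N * e).+1 * (m * q.+1) ^ s) ^ (2 * N) *
    ((\prod_(i < m) biclique (level m f i)) ^ N * q.+1 ^ (2 * (m + 2 * D * N))).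
Proof.
(* Coordinate vectors are sorted by the top [c.1] of a window and a list [c.2] of N e distinct gaps
   in it, at most (f + 1)^(N e + 1) classes; each class is then bounded by containers. *)
move=> KP; pose C := ('I_f.+1 * {ffun 'I_(N * e) -> 'I_f.+1})%type.
pose window (c : C) := injectiveb c.2 && [forall a, c.2 a <= c.1 < c.2 a + D].
pose Kc (c : C) := [set k in K | [&& window c,
  [forall a, forall i : 'I_m, level m (c.2 a) i <= k i + k (reflect_mod m_gt0 (c.2 a) i)]
  & #|[set i : 'I_m | level m c.1 i < k i]| <= M * (N * e)]].
have KcP c : #|Kc c| ^ (2 * N) <= (m * q.+1) ^ (s * (2 * N)) *
    ((\prod_(i < m) biclique (level m f i)) ^ N * q.+1 ^ (2 * (m + 2 * D * N))).
  have [wc|wc] := boolP (window c); last first.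
    suff -> : Kc c = finset.set0 by rewrite cards0 exp0n // muln_gt0.
    by apply/setP => k; rewrite !inE (negbTE wc) andbF.
  case/andP: wc => /injectiveP inj_c /forallP win_c.
  have le_cf : c.1 <= f by rewrite -ltnS.
  (* Containers give the levels at [c.1]; by monotonicity these may be raised to the levels at [f],
     which makes the bound uniform in [c]. *)
  apply: (@leq_trans ((m * q.+1) ^ (s * (2 * N)) *
    ((\prod_(i < m) biclique (level m c.1 i)) ^ N * q.+1 ^ (2 * (m + 2 * D * N))))).
    rewrite -[X in (X * q.+1) ^ _]card_ord -[X in 2 * (X + _)]card_ord.
    apply: (@card_admissible_le 'I_m 'I_(N * e) q e
      (fun a => reflect_mod m_gt0 (c.2 a)) (fun a i => level m (c.2 a) i)
      (fun i => level m c.1 i) _ _ _ _ _ D _ s (Ordinal m_gt0) (Kc c) (M * (N * e)) N).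
    - by move=> a; apply: reflect_modK.
    - move=> i a b; move/(reflect_mod_inj leDm (win_c a) (win_c b)).
      by move/val_inj/inj_c.
    - by move=> a i; apply: level_reflect_mod.
    - by move=> a i; apply: leq_level; case/andP: (win_c a).
    - by move=> i; apply: level_le; apply: leq_ltn_trans f_lt.
    - by move=> a; apply: card_level_mismatch.
    - by [].
    - by rewrite card_ord.
    - by rewrite card_ord.
    move=> k; rewrite inE => /and4P[_ _ /forallP adm few]; split.
      by move=> a i; have /forallP := adm a; apply.
    by exists [set i : 'I_m | level m c.1 i < k i] => // i; rewrite inE -leqNgt.
  rewrite leq_mul2l leq_mul2r; apply/orP; right; apply/orP; right.
  by apply/leq_expn_base/leq_prod => i _; apply/leq_biclique/leq_level.
have sub : K \subset \bigcup_(c : C) Kc c.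
  apply/fintype.subsetP => k kK; have [L LP kL] := KP k kK.
  have [c [few many]] := exists_window LP fMD ltMd.
  set W := [set g in gaps L f | g <= c < g + D] in many.
  pose G := [ffun a : 'I_(N * e) => nth ord0 (enum W) a].
  have GW a : G a \in W.
    by rewrite ffunE -mem_enum mem_nth // -cardE (leq_trans (ltn_ord a)).
  apply/finset.bigcupP; exists (c, G) => //; rewrite inE kK /=; apply/and3P; split.
  - apply/andP; split; last by apply/forallP => a; have := GW a; rewrite inE => /andP[].
    apply/injectiveP => a b; rewrite !ffunE => /eqP.
    rewrite nth_uniq ?enum_uniq -?cardE ?(leq_trans (ltn_ord _)) //.
    by move/eqP/val_inj.
  - apply/forallP => a; apply/forallP => i; rewrite !kL; apply: (kunz_add_ge LP).
    by have := GW a; rewrite !inE => /andP[].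
  apply: leq_trans few; apply: leq_trans (card_kunz_gt LP c).
  by apply/subset_leq_card/fintype.subsetP => i; rewrite !inE kL.
case: (@arg_maxnP _ (ord0, [ffun=> ord0]) predT (fun c => #|Kc c|) isT) => c0 _ maxc0.
have cK : #|K| <= f.+1 ^ (N * e).+1 * #|Kc c0|.
  apply: leq_trans (subset_leq_card sub) _; apply: leq_trans (leq_card_bigcup _) _.
  apply: (@leq_trans (\sum_(c : C) #|Kc c0|)); first by apply: leq_sum => c _; apply: maxc0.
  by rewrite sum_nat_const card_prod card_ffun !card_ord expnS.
apply: leq_trans (leq_expn_base _ cK) _.
rewrite expnMn expnMn -mulnA leq_mul2l; apply/orP; right.
by rewrite -expnM; exact: KcP.
Qed.

End Count.

(** * Counting the sample space *)

(** The r + 1 residues 0, ..., r have level Q + 1, all others level Q. *)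
Lemma prod_biclique_level (m Q r : nat) : r < m ->
  \prod_(i < m) biclique (level m (Q * m + r) i) =
  biclique Q.+1 ^ r.+1 * biclique Q ^ (m - r.+1).
Proof.
move=> lt_rm; have m_gt0 : 0 < m by apply: leq_ltn_trans lt_rm.
rewrite -(big_mkord xpredT (fun i => biclique (level m (Q * m + r) i))).
rewrite (big_cat_nat _ (n := r.+1)) //=; congr (_ * _).
  rewrite big_nat (eq_bigr (fun=> biclique Q.+1)) => [|i /andP[_ le_ir]].
    by rewrite -big_nat prod_nat_const_nat subn0.
  have -> : level m (Q * m + r) i = Q.+1 + (r - i) %/ m.
    by rewrite -divnMDl // mulSn /level; congr (_ %/ _); lia.
  by rewrite divn_small ?addn0 //; lia.
rewrite big_nat (eq_bigr (fun=> biclique Q)) => [|i /andP[lt_ri lt_im]].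
  by rewrite -big_nat prod_nat_const_nat.
have -> : level m (Q * m + r) i = Q + (r + m - i) %/ m.
  by rewrite -divnMDl // /level; congr (_ %/ _); lia.
by rewrite divn_small ?addn0 //; lia.
Qed.

Lemma multiplicity_unique (L : nat -> Prop) (m m' : nat) :
  is_multiplicity L m -> is_multiplicity L m' -> m = m'.
Proof.
move=> [m0 [Lm min_m]] [m0' [Lm' min_m']].
by have [lt|lt|//] := ltngtP m m'; [case: (min_m' m) | case: (min_m m')].
Qed.

Lemma conductor_unique (L : nat -> Prop) (c c' : nat) :
  is_conductor L c -> is_conductor L c' -> c = c'.
Proof.
move=> [Lc min_c] [Lc' min_c']; apply/eqP; rewrite eqn_leq.
by rewrite (min_c _ Lc') (min_c' _ Lc).
Qed.

(** For conductor f + 1 the depth condition reads q = floor((f + m) / m), that is (q - 1) m <= f < q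
    m. *)
Lemma sample_spec (q f m : nat) (A : {set 'I_f.+1}) : 1 < q ->
  A \in sample_space q f -> is_multiplicity (sg_of A) m ->
  semigroup_spec (fun n => `[< sg_of A n >]) f m q /\ q.-1 * m <= f.
Proof.
move=> q_gt1; rewrite inE => /asboolP[[L0 [Ladd _]] [frob [c [m' [condc [multm' qE]]]]]] multm.
move: condc multm' qE => /(conductor_unique frob) <- /(multiplicity_unique multm) <-.
have [m_gt0 [Lm minm]] := multm; rewrite addSn subn1 /= => qE.
have lo : q * m <= f + m by rewrite qE leq_trunc_div.
have hi : f + m < q.+1 * m by rewrite {1}qE ltn_ceil.
have lo' : q.-1 * m <= f by rewrite -subn1 mulnBl mul1n leq_subLR addnC.
split => //; split => //.
- by move=> x y /asboolP Lx /asboolP Ly; apply/asboolP/Ladd.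
- exact/asboolP.
- exact/asboolP.
- by move=> x /andP[x0 xm]; apply/negP => /asboolP; apply: minm.
- by move=> x xf; apply/asboolP; left.
- by move: hi; rewrite mulSn; lia.
- by apply: leq_trans lo'; rewrite leq_pmull //; lia.
Qed.

Definition sample_mult (q f m : nat) : {set {set 'I_f.+1}} :=
  [set A in sample_space q f | `[< is_multiplicity (sg_of A) m >]].

Lemma card_sample_mult_le (q f m N e M D s : nat) :
  1 < q -> 0 < e -> 0 < N -> f <= M * D -> D <= m -> M * (N * e) < m.-1 ->
  q * m %/ e + M * (N * e) <= s ->
  #|sample_mult q f m| ^ (2 * N) <= (f.+1 ^ (N * e).+1 * (m * q.+1) ^ s) ^ (2 * N) *
    ((\prod_(i < m) biclique (level m f i)) ^ N * q.+1 ^ (2 * (m + 2 * D * N))).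
Proof.
move=> q_gt1 e0 N0 fMD Dm ltMd les.
(* A member [A0], when there is one, supplies 0 < m and f < q m. *)
have [->|[A0]] := set_0Vmem (sample_mult q f m); first by rewrite cards0 exp0n // muln_gt0.
rewrite inE => /andP[A0s /asboolP A0m]; have [A0P _] := sample_spec q_gt1 A0s A0m.
pose L (A : {set 'I_f.+1}) n := `[< sg_of A n >].
pose F (A : {set 'I_f.+1}) : {ffun 'I_m -> 'I_q.+1} := [ffun i : 'I_m => inord (kunz (L A) m q i)].
have FE A i : F A i = kunz (L A) m q i :> nat by rewrite ffunE inordK // ltnS kunz_le.
have LP A : A \in sample_mult q f m -> semigroup_spec (L A) f m q.
  by rewrite inE => /andP[As /asboolP Am]; have [] := sample_spec q_gt1 As Am.
rewrite -(card_in_imset (f := F)).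
  apply: (card_kunz_le (spec_gt0 A0P) e0 N0 (spec_frob_lt A0P) fMD Dm ltMd les).
  by move=> k /imsetP[A As ->]; exists (L A); [exact: LP | move=> i; apply: FE].
move=> A B As Bs eqF; have m0 := spec_gt0 A0P.
have memL (C : {set 'I_f.+1}) (x : 'I_f.+1) : (x \in C) = L C x.
  apply/idP/asboolP => [xC|[]]; first by right; exists x.
    by rewrite ltnNge -ltnS ltn_ord.
  by move=> [y [yC /val_inj <-]].
apply/setP => x; rewrite !memL (divn_eq x m).
rewrite (kunzE (LP A As)) (kunzE (LP B Bs)).
by rewrite -!(FE _ (Ordinal (ltn_pmod x m0))) eqF.
Qed.

(** * Semigroups with prescribed Kunz coordinates *)

Section FromKunz.

Variables (q m r : nat) (k : nat -> nat).
Hypotheses (q_ge3 : 3 <= q) (r_gt0 : 0 < r) (lt_rm : r < m).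
Hypothesis k0 : k 0 = 0.
Hypothesis k_lt_r : forall i, 0 < i < r -> k i = q.-1.
Hypothesis k_r : k r = q.
Hypothesis k_le : forall i, i != r -> k i <= q.-1.
Hypothesis k_ge : forall i, 0 < i < m -> (q.-1)./2 <= k i.
Hypothesis k_ge_low : forall i, 0 < i < m -> i.*2 <= m + r -> q./2 <= k i.

Let f := q.-1 * m + r.

Definition from_kunz : {set 'I_f.+1} := [set x : 'I_f.+1 | k (x %% m) <= x %/ m].

Lemma from_kunz_gt_frob x : f < x -> k (x %% m) <= x %/ m.
Proof.
have m_gt0 : 0 < m by lia.
move=> fx; have le : q.-1 <= x %/ m by rewrite leq_divRL //; rewrite /f in fx; lia.
have [eq_r|ne] := eqVneq (x %% m) r; last exact: leq_trans (k_le ne) le.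
rewrite eq_r k_r; have : q.-1 != x %/ m.
  by apply: contraTneq fx => eqx; rewrite /f eqx -{1}eq_r -divn_eq ltnn.
by move: le; move: (x %/ m) => y; lia.
Qed.

Lemma sg_of_from_kunz x : sg_of from_kunz x <-> k (x %% m) <= x %/ m.
Proof.
split=> [[/from_kunz_gt_frob //|[i [+ <-]]]|kx]; first by rewrite inE.
have [le|lt] := leqP x f; last by left.
by right; exists (inord x); rewrite inE inordK ?ltnS.
Qed.

(** If i + j <= m + r, the smaller residue is in the low range, so k_i + k_j >= floor(q/2) +
    floor((q-1)/2) = q - 1. A sum landing on r without carry has both residues below r and gets 2 (q
    - 1) >= q; with carry, i + j = m + r and the carry adds the missing 1. Any other sum with carry
    needs only 2 floor((q-1)/2) + 1 >= q - 1. *)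
Lemma from_kunz_add x y : k (x %% m) <= x %/ m -> k (y %% m) <= y %/ m ->
  k ((x + y) %% m) <= (x + y) %/ m.
Proof.
have m_gt0 : 0 < m by lia.
rewrite divnD // -modnDm.
have := ltn_pmod x m_gt0; have := ltn_pmod y m_gt0.
move: (x %% m) (y %% m) (x %/ m) (y %/ m) => i j a b jm im ka kb.
have [i0|i_gt0] := posnP i.
  by rewrite i0 add0n modn_small // [m <= j]leqNgt jm addn0 (leq_trans kb) ?leq_addl.
have [j0|j_gt0] := posnP j.
  by rewrite j0 addn0 modn_small // [m <= i]leqNgt im addn0 (leq_trans ka) ?leq_addr.
have hq := odd_double_half q; have hq1 := odd_double_half q.-1.
have im' : 0 < i < m by rewrite i_gt0.
have jm' : 0 < j < m by rewrite j_gt0.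
have gi := k_ge im'; have gj := k_ge jm'.
have li := k_ge_low im'; have lj := k_ge_low jm'.
have low : i + j <= m + r -> q.-1 <= k i + k j.
  move=> le; have [le_i|lt_i] := leqP i.*2 (m + r).
    by move: (li le_i); lia.
  have le_j : j.*2 <= m + r by lia.
  by move: (lj le_j); lia.
have [lt|ge] := ltnP (i + j) m.
  rewrite modn_small // addn0.
  have [eqr|ne] := eqVneq (i + j) r.
    by rewrite eqr k_r; have := k_lt_r (i := i); have := k_lt_r (i := j); lia.
  by apply: leq_trans (k_le ne) _; apply: leq_trans (low _) _; lia.
have -> : (i + j) %% m = i + j - m by rewrite -{1}(subnK ge) modnDr modn_small //; lia.
rewrite addn1.
have [eqr|ne] := eqVneq (i + j - m) r; first by rewrite eqr k_r; have := low; lia.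
by apply: leq_trans (k_le ne) _; lia.
Qed.

Lemma from_kunz_sample : from_kunz \in sample_space q f.
Proof.
have m_gt0 : 0 < m by lia.
have frob : has_frobenius (sg_of from_kunz) f.
  split=> [x fx|c Lc]; first by left.
  rewrite ltnNge; apply/negP => /Lc /sg_of_from_kunz.
  by rewrite /f modnMDl modn_small // k_r divnMDl // divn_small //; lia.
rewrite inE; apply/asboolP; split; [split; [|split]|split] => //.
- by apply/sg_of_from_kunz; rewrite mod0n k0.
- move=> x y /sg_of_from_kunz kx /sg_of_from_kunz ky; apply/sg_of_from_kunz.
  exact: from_kunz_add.
- by exists f.+1 => x fx; left.
exists f.+1, m; split=> //; split; last first.
  rewrite addSn subn1 /= /f addnAC -mulSnr divnMDl // divn_small //; lia.
split=> //; split; first by apply/sg_of_from_kunz; rewrite modnn k0.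
move=> x x0 xm /sg_of_from_kunz; rewrite modn_small // divn_small //.
have := k_ge (i := x); rewrite x0 xm => /(_ isT).
by have := odd_double_half q.-1; lia.
Qed.

End FromKunz.

Lemma from_kunz_inj (q m r : nat) (k k' : nat -> nat) :
  (forall x, q.-1 * m + r < x -> k (x %% m) <= x %/ m) ->
  (forall x, q.-1 * m + r < x -> k' (x %% m) <= x %/ m) ->
  from_kunz q m r k = from_kunz q m r k' -> forall i, i < m -> k i = k' i.
Proof.
move=> kf kf' /setP eqA i im; have m_gt0 : 0 < m by apply: leq_ltn_trans im.
have le n : (k i <= n) = (k' i <= n).
  have -> : i = (n * m + i) %% m by rewrite modnMDl modn_small.
  have {2 4}-> : n = (n * m + i) %/ m by rewrite divnMDl // divn_small // addn0.
  move: (n * m + i) => x; have [le|lt] := leqP x (q.-1 * m + r).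
    have := eqA (inord x); rewrite !inE inordK ?ltnS //.
  by rewrite kf // kf'.
by apply/eqP; rewrite eqn_leq le leqnn -le leqnn.
Qed.

(** * Lower bound by independent choices of coordinates *)

Section LowerBound.

Variables (q m r : nat).
Hypotheses (q_ge3 : 3 <= q) (r_gt0 : 0 < r) (lt_rm : r < m).

(** For j < u the residues r + 1 + j and m - 1 - j sum to m + r and lie on either side of the
    midpoint. Their labels range over [q/2, q-1] and [(q-1)/2, q-1], with floors, which gives
    [biclique q.-1] choices for each pair. *)
Let u := m.-1 - (m + r)./2.
Let Y := {ffun 'I_u -> 'I_(q.+1)./2 * 'I_(q.+2)./2}.

(** The default 0 serves the residue (m + r) / 2, which is unpaired when m + r is even. *)
Definition choice_at (n : nat) (y : 'I_u -> 'I_n) (j : nat) : nat :=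
  oapp (fun j => nat_of_ord (y j)) 0 (insub j).

Lemma choice_at_ord n (y : 'I_u -> 'I_n) (j : 'I_u) : choice_at y j = y j.
Proof. by rewrite /choice_at valK. Qed.

Lemma choice_at_lt n (y : 'I_u -> 'I_n) j : 0 < n -> choice_at y j < n.
Proof. by move=> n0; rewrite /choice_at; case: insub => [i|//]; apply: ltn_ord. Qed.

Definition choice_kunz (y : Y) (i : nat) : nat :=
  if i == 0 then 0 else if i < r then q.-1 else if i == r then q else
  if i.*2 <= m + r then q./2 + choice_at (fun j => (y j).1) (i - r.+1)
  else (q.-1)./2 + choice_at (fun j => (y j).2) (m.-1 - i).

Lemma choice_kunz_low (y : Y) (j : 'I_u) : choice_kunz y (r.+1 + j) = q./2 + (y j).1.
Proof.
have ju : j < m.-1 - (m + r)./2 := ltn_ord j.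
have hu := odd_double_half (m + r).
rewrite /choice_kunz addKn choice_at_ord.
by repeat (case: ifP => ?); lia.
Qed.

Lemma choice_kunz_high (y : Y) (j : 'I_u) :
  choice_kunz y (m.-1 - j) = (q.-1)./2 + (y j).2.
Proof.
have ju : j < m.-1 - (m + r)./2 := ltn_ord j.
have hu := odd_double_half (m + r).
have jE : m.-1 - (m.-1 - j) = j by lia.
rewrite /choice_kunz jE choice_at_ord.
by repeat (case: ifP => ?); lia.
Qed.

Lemma card_sample_ge : biclique q.-1 ^ u <= #|sample_space q (q.-1 * m + r)|.
Proof.
have hq := odd_double_half q; have hq1 := odd_double_half q.-1.
have hq2 := odd_double_half q.+1; have hq3 := odd_double_half q.+2.
have hu := odd_double_half (m + r).
have -> : biclique q.-1 = #|{: 'I_(q.+1)./2 * 'I_(q.+2)./2}|.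
  by rewrite card_prod !card_ord /biclique; congr (_./2 * _./2); lia.
rewrite -[u]card_ord -card_ffun.
have c1 (y : Y) j : choice_at (fun j => (y j).1) j < (q.+1)./2 by apply: choice_at_lt; lia.
have c2 (y : Y) j : choice_at (fun j => (y j).2) j < (q.+2)./2 by apply: choice_at_lt; lia.
have k_le (y : Y) i : i != r -> choice_kunz y i <= q.-1.
  move=> ne; rewrite /choice_kunz (negbTE ne); have := c1 y (i - r.+1).
  have := c2 y (m.-1 - i); move: (choice_at _ _) (choice_at _ _) => a b.
  by repeat (case: ifP => _); lia.
have k_r (y : Y) : choice_kunz y r = q.
  by rewrite /choice_kunz eqxx ltnn; case: eqP => //; lia.
have gt_frob (y : Y) : forall x, q.-1 * m + r < x -> choice_kunz y (x %% m) <= x %/ m.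
  exact: from_kunz_gt_frob (k_r y) (k_le y).
pose F (y : Y) := from_kunz q m r (choice_kunz y).
rewrite -(card_codom (f := F)).
  apply/subset_leq_card/fintype.subsetP => _ /codomP[y ->].
  apply: (@from_kunz_sample q m r (choice_kunz y)) => //.
  - move=> i /andP[i0 ir]; rewrite /choice_kunz ir; case: eqP => //; lia.
  - exact: k_le.
  - move=> i /andP[i0 im]; rewrite /choice_kunz.
    by case: eqP => [|_]; [lia|repeat (case: ifP => _); lia].
  - move=> i /andP[i0 im] low; rewrite /choice_kunz low.
    by case: eqP => [|_]; [lia|repeat (case: ifP => _); lia].
move=> y y' eqF; apply/ffunP => j.
have eqk := from_kunz_inj (gt_frob y) (gt_frob y') eqF.
have ju : j < m.-1 - (m + r)./2 := ltn_ord j.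
have e1 : (y j).1 = (y' j).1.
  by apply: val_inj; apply: (@addnI q./2); rewrite -!choice_kunz_low eqk //; lia.
have e2 : (y j).2 = (y' j).2.
  by apply: val_inj; apply: (@addnI q.-1./2); rewrite -!choice_kunz_high eqk //; lia.
by move: e1 e2; case: (y j) (y' j) => [a b] [a' b'] /= -> ->.
Qed.

End LowerBound.

Lemma card_sample_ge_frob (q f : nat) : 3 <= q -> q * q < f ->
  biclique q.-1 ^ f <= #|sample_space q f| ^ (2 * q.-1) * biclique q.-1 ^ (q.-1 * (q.+2)).
Proof.
move=> q3 qf; set Q := q.-1; have Q_gt0 : 0 < Q by rewrite /Q; lia.
(* Dividing f - 1 instead of f places r in [1, q - 1], so that r is positive and bounded. *)
pose m := f.-1 %/ Q; pose r := (f.-1 %% Q).+1.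
have fE : f = Q * m + r by rewrite /r addnS mulnC -divn_eq prednK //; lia.
have le_rQ : r <= Q by rewrite /r ltn_pmod.
have le_qm : q <= m by rewrite leq_divRL // /Q; nia.
have lt_rm : r < m by rewrite /Q in le_rQ; lia.
have := card_sample_ge q3 (isT : 0 < r) lt_rm; rewrite -/Q -fE => /(leq_expn_base (2 * Q)) le.
apply: leq_trans (leq_mul le (leqnn _)); rewrite -expnM -expnD leq_pexp2l ?biclique_gt0 //.
have hu := odd_double_half (m + r).
rewrite {1}fE; have : m <= 2 * (m.-1 - (m + r)./2) + r + 2 by lia.
move: (m.-1 - _) => u lem.
have : Q * m <= Q * (2 * u + r + 2) by rewrite leq_mul2l lem orbT.
have : Q * r <= Q * Q by rewrite leq_mul2l le_rQ orbT.
have -> : q.+2 = Q + 3 by rewrite /Q; lia.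
by clear -le_rQ; lia.
Qed.

(** * Comparison of the growth rates *)

(** Induction, using x (x + 2) <= (x + 1)^2 after multiplication by x^x. *)
Lemma succ_pow_lt (u : nat) : 1 < u -> u.+1 ^ u.-1 < u ^ u.
Proof.
elim: u => // -[|[|u]] // IH _; have {}IH := IH isT.
set x := u.+2 in IH *; have x_gt0 : 0 < x by [].
rewrite -(ltn_pmul2r (m := x ^ x)) ?expn_gt0 ?x_gt0 //=.
apply: leq_ltn_trans (_ : _ <= x.+1 ^ (x + x)) _.
  by rewrite expnD -!expnMn leq_expn_base //; nia.
have -> : x + x = x.+1 + x.-1 by rewrite /x; lia.
by rewrite expnD ltn_pmul2l ?expn_gt0.
Qed.

(** With u = floor((q+1)/2) and v = floor((q+2)/2) the two values are v (u + 1) and u v, which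
    leaves (u + 1)^(q-1) < u^q v. This is the square of [succ_pow_lt], multiplied by u + 1 when q is
    even. *)
Lemma biclique_pow_lt (q : nat) : 3 <= q -> biclique q ^ q.-1 < biclique q.-1 ^ q.
Proof.
move=> q3; have hq := odd_double_half q.+1; have hq' := odd_double_half q.+2.
pose u := q.+1./2; have u_gt1 : 1 < u by rewrite /u; lia.
pose v := q.+2./2; have v_gt0 : 0 < v by [].
have -> : biclique q.-1 = u * v by rewrite /biclique /u /v; congr (_./2 * _./2); lia.
have -> : biclique q = v * u.+1 by [].
rewrite !expnMn mulnC.
have key : u.+1 ^ q.-1 < u ^ q * v.
  have lt := succ_pow_lt u_gt1.
  have lt2 : u.+1 ^ (u.-1 + u.-1) < u ^ (u + u).
    by rewrite !expnD (leq_ltn_trans (leq_mul (leqnn _) (ltnW lt))) // ltn_pmul2r // expn_gt0; lia.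
  have [oq|eq] := boolP (odd q).
    have -> : q.-1 = u.-1 + u.-1 by rewrite /u; lia.
    have -> : v = u by rewrite /u /v; lia.
    have -> : u ^ q * u = u ^ (u + u) by rewrite -expnSr; congr (_ ^ _); rewrite /u; lia.
    by [].
  have -> : q.-1 = (u.-1 + u.-1).+1 by rewrite /u; lia.
  have -> : v = u.+1 by rewrite /u /v; lia.
  have -> : u ^ q = u ^ (u + u) by congr (_ ^ _); rewrite /u; lia.
  by rewrite expnSr ltn_pmul2r.
have -> : v ^ q = v * v ^ q.-1 by rewrite -expnS prednK //; lia.
by rewrite mulnA ltn_pmul2r // expn_gt0 v_gt0.
Qed.

(** * Asymptotic comparison *)

Lemma exists_sqrt (n : nat) : exists e, e * e <= n < e.+1 * e.+1.
Proof.
elim: n => [|n [e /andP[lo hi]]]; first by exists 0.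
have [lt|ge] := ltnP n.+1 (e.+1 * e.+1); first by exists e; rewrite lt andbT ltnW.
by exists e.+1; rewrite ge /=; nia.
Qed.

(** [e] is the integer square root of [f]. It balances the q m / e fingerprint entries against the
    N^2 e exceptional ones, so the code has O(sqrt f) entries, while the window length is about f /
    N. *)
Lemma window_parameters (q f m N e : nat) :
  1 < q -> 2 * q <= N -> q.+1 * (N * N + 2) <= e -> e * e <= f < e.+1 * e.+1 ->
  f < q * m -> m <= f ->
  [/\ f <= N * (f %/ N).+1, (f %/ N).+1 <= m, N * (N * e) < m.-1
    & q * m %/ e + N * (N * e) <= q * (e + 2) + N * (N * e)].
Proof.
move=> q_gt1 N2q e_ge /andP[lo hi] f_lt m_le; have q_gt0 : 0 < q by apply: ltnW.
have N_gt0 : 0 < N by apply: leq_trans N2q; rewrite muln_gt0.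
have e_gt0 : 0 < e by apply: leq_trans e_ge; rewrite muln_gt0 addn2.
split.
- by rewrite ltnW // mulnC ltn_ceil.
- have h1 : 2 * q * (f %/ N) <= f.
    by apply: leq_trans (leq_trunc_div f N); rewrite mulnC leq_mul2l N2q orbT.
  have : q * (2 * (f %/ N)) < q * m by apply: leq_ltn_trans f_lt; rewrite mulnCA mulnA.
  by rewrite ltn_pmul2l //; move: (f %/ N) => x; clear; lia.
- have h1 : q * (e * (N * N + 2)) < q * m.
    apply: leq_ltn_trans f_lt; apply: leq_trans lo; rewrite mulnCA leq_mul2l.
    by apply/orP; right; apply: leq_trans e_ge; rewrite leq_mul2r leqnSn orbT.
  move: h1; rewrite ltn_pmul2l // mulnDr [e * (N * N)]mulnC -mulnA.
  by clear -e_gt0; move: (N * (N * e)) => x; lia.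
rewrite leq_add2r -[X in _ <= X](mulnK _ e_gt0) leq_div2r // -mulnA leq_mul2l.
apply/orP; right; rewrite mulnDl; clear -hi m_le; lia.
Qed.

Lemma code_exponent_le (q N e : nat) :
  (N * e).+2 + (q * (e + 2) + N * (N * e)) <= (N + 2 + 2 * q + N * N) * e.+1.
Proof. nia. Qed.

Local Open Scope ring_scope.

(** * Logarithmic estimates *)

Section Asymptotics.

Variable R : realType.
Implicit Types (x y c d eps eta : R).

Lemma ln_natX (n k : nat) : (0 < n)%N -> ln ((n ^ k)%:R : R) = k%:R * ln n%:R.
Proof. by move=> n0; rewrite natrX lnXn ?ltr0n // mulr_natl. Qed.

Lemma ln_natM (n k : nat) : (0 < n)%N -> (0 < k)%N ->
  ln ((n * k)%:R : R) = ln n%:R + ln k%:R.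
Proof. by move=> n0 k0; rewrite natrM lnM ?posrE ?ltr0n. Qed.

Lemma ler_ln_nat (n k : nat) : (0 < n)%N -> (n <= k)%N -> ln (n%:R : R) <= ln k%:R.
Proof. by move=> n0 le; rewrite ler_ln ?posrE ?ltr0n ?ler_nat // (leq_trans n0). Qed.

Lemma ln_nat_ge0 (n : nat) : (0 < n)%N -> 0 <= ln (n%:R : R).
Proof. by move=> n0; apply: ln_ge0; rewrite ler1n. Qed.

Lemma ln_growth c c' d : 0 <= c -> 0 < d ->
  exists n0, forall n, (n0 <= n)%N ->
    c * n.+1%:R * (2 * ln n.+1%:R + c') <= d * (n%:R * n%:R).
Proof.
move=> c_ge0 d_gt0.
(* With t = sqrt(n + 1), the bounds ln(n + 1) <= 2 t and c' <= t make the left side at most 5 c t^3,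
   while n^2 >= t^4 / 4; hence 20 = 5 * 4. *)
pose b := 1 + `|c'| + 20 * c / d; have b_ge1 : 1 <= b.
  by rewrite /b -addrA lerDl addr_ge0 // divr_ge0 ?mulr_ge0 // ltW.
exists (Num.truncn (2 * (b * b))).+1 => n le_n.
have bn : 2 * (b * b) <= n%:R.
  apply: le_trans (_ : (Num.truncn (2 * (b * b))).+1%:R <= _); last by rewrite ler_nat.
  exact/ltW/truncnS_gt.
set t := Num.sqrt (n.+1%:R : R).
have t2 : t * t = n.+1%:R by rewrite -expr2 sqr_sqrtr.
have t_ge0 : 0 <= t by apply: sqrtr_ge0.
have nS : n.+1%:R = n%:R + 1 :> R by rewrite -natr1.
have bt : b <= t by rewrite -ler_sqr ?nnegrE ?expr2 ?t2 //; nra.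
have lnt : ln n.+1%:R <= 2 * t.
  have t_gt0 : 0 < t by lra.
  rewrite -t2 lnM ?posrE //; have := ln_sublinear t_gt0; lra.
have c't : c' <= t.
  apply: le_trans (ler_norm c') _; apply: le_trans bt; rewrite /b.
  have : 0 <= 20 * c / d by rewrite divr_ge0 ?mulr_ge0 // ltW.
  lra.
have ct : 20 * c <= d * t.
  rewrite [d * t]mulrC -ler_pdivrMr //; apply: le_trans bt; rewrite /b.
  by rewrite lerDr addr_ge0.
have n_ge : t * t <= 2 * n%:R by rewrite t2 nS; nra.
rewrite -t2.
have s1 : c * (t * t) * (2 * ln n.+1%:R + c') <= c * (t * t) * (5 * t).
  by rewrite ler_wpM2l ?mulr_ge0 //; lra.
rewrite t2 in s1 *; apply: le_trans s1 _; rewrite -t2.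
have s2 : (t * t) * (t * t) <= 4 * (n%:R * n%:R).
  have := ler_pM (mulr_ge0 t_ge0 t_ge0) (mulr_ge0 t_ge0 t_ge0) n_ge n_ge; lra.
have s3 : (20 * c) * (t * t * t) <= d * t * (t * t * t).
  by rewrite ler_wpM2r ?mulr_ge0.
have s4 : d * ((t * t) * (t * t)) <= d * (4 * (n%:R * n%:R)) by rewrite ler_wpM2l // ltW.
lra.
Qed.

Lemma ln_card_sample_ge (q f : nat) : (3 <= q)%N -> (q * q < f)%N ->
  (0 < #|sample_space q f|)%N /\
  f%:R * ln (biclique q.-1)%:R <= 2 * q.-1%:R * ln #|sample_space q f|%:R
    + q.-1%:R * q.+2%:R * ln (biclique q.-1)%:R :> R.
Proof.
move=> q3 qf; have le := card_sample_ge_frob q3 qf; have a_gt0 := biclique_gt0 q.-1.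
have T_gt0 : (0 < #|sample_space q f|)%N.
  rewrite lt0n; apply: contraTneq le => ->; rewrite exp0n; last by lia.
  by rewrite mul0n -ltnNge expn_gt0 a_gt0.
split => //; have /(ler_ln_nat _) := le; rewrite expn_gt0 a_gt0 => /(_ isT).
by rewrite ln_natM ?expn_gt0 ?a_gt0 ?T_gt0 // !ln_natX // !natrM.
Qed.

Lemma ln_card_sample_mult_le (q f m r N e D s : nat) :
  (1 < q)%N -> (0 < e)%N -> (0 < N)%N -> (f <= N * D)%N -> (D <= m)%N ->
  (N * (N * e) < m.-1)%N -> (q * m %/ e + N * (N * e) <= s)%N ->
  (r < m)%N -> f = (q.-1 * m + r)%N -> (0 < #|sample_mult q f m|)%N ->
  2 * N%:R * ln #|sample_mult q f m|%:R <=
    2 * N%:R * ((N * e).+1%:R * ln f.+1%:R + s%:R * (ln m%:R + ln q.+1%:R))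
    + N%:R * ((r%:R + 1) * ln (biclique q)%:R
              + (m%:R - r%:R - 1) * ln (biclique q.-1)%:R)
    + 2 * (m%:R + 2 * D%:R * N%:R) * ln q.+1%:R :> R.
Proof.
move=> q_gt1 e0 N0 fND Dm ltN les rm fE x_gt0.
have m0 : (0 < m)%N by apply: leq_ltn_trans rm.
have := card_sample_mult_le q_gt1 e0 N0 fND Dm ltN les.
have -> : (\prod_(i < m) biclique (level m f i) = biclique q ^ r.+1 * biclique q.-1 ^ (m - r.+1))%N.
  by rewrite fE prod_biclique_level // prednK // ltnW.
move/ler_ln_nat; rewrite expn_gt0 x_gt0 => /(_ isT).
have a0 := biclique_gt0 q.-1; have b0 := biclique_gt0 q.
do !rewrite ?ln_natX ?ln_natM ?muln_gt0 ?expn_gt0 ?a0 ?b0 ?m0 //.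
have -> : (m - r.+1)%:R = m%:R - r%:R - 1 :> R by rewrite natrB // -natr1; lra.
by rewrite -[r.+1%:R]natr1 !(natrM, natrD); move=> le; lra.
Qed.

Lemma exponent_gap_gt0 (q : nat) : (3 <= q)%N ->
  0 < q%:R * ln (biclique q.-1)%:R - q.-1%:R * ln (biclique q)%:R :> R.
Proof.
move=> q3; rewrite subr_gt0 -!ln_natX ?biclique_gt0 //.
by rewrite ltr_ln ?posrE ?ltr0n ?expn_gt0 ?biclique_gt0 // ltr_nat biclique_pow_lt.
Qed.

(** In the difference of the upper and lower exponents the terms in m cancel and -r K remains, where
    K > 0 is the gap of [exponent_gap_gt0] and r >= eps f. The summand ln(f + 1) prepares a union
    bound over the multiplicities. *)
Lemma sample_mult_exponent_lt (q : nat) eps : (3 <= q)%N -> 0 < eps ->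
  exists c (C : R) n0, 0 < c /\ forall f m : nat, (n0 <= f)%N ->
    (0 < #|sample_mult q f m|)%N -> eps * f%:R <= f%:R - q.-1%:R * m%:R ->
    ln #|sample_mult q f m|%:R + ln f.+1%:R <= ln #|sample_space q f|%:R - c * f%:R + C.
Proof.
move=> q3 eps0.
set la : R := ln (biclique q.-1)%:R; set lb : R := ln (biclique q)%:R.
set lq : R := ln q.+1%:R; set Q : R := q.-1%:R.
have K_gt0 := exponent_gap_gt0 q3; rewrite -/la -/lb -/Q in K_gt0.
set K := (X in 0 < X) in K_gt0.
have qE : q%:R = Q + 1 :> R by rewrite /Q natr1 prednK //; lia.
have Q_gt0 : 0 < Q by rewrite ltr0n; lia.
have la_ge0 : 0 <= la by rewrite ln_nat_ge0 ?biclique_gt0.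
have lb_ge0 : 0 <= lb by rewrite ln_nat_ge0 ?biclique_gt0.
have lq_ge0 : 0 <= lq by rewrite ln_nat_ge0.
have eK_gt0 : 0 < eps * K by rewrite mulr_gt0.
(* The mismatch term, about 6 Q lq f / N, is to use at most half of eps K f. *)
have [N N2q NK] : exists2 N, (2 * q <= N)%N & 12 * Q * lq <= N%:R * (eps * K).
  exists (maxn (2 * q) (Num.truncn (12 * Q * lq / (eps * K))).+1); first exact: leq_maxl.
  rewrite -ler_pdivrMr //; apply/ltW/(lt_le_trans (truncnS_gt _)).
  by rewrite ler_nat leq_maxr.
have q_gt1 : (1 < q)%N by exact: ltnW.
have N_gt0 : (0 < N)%N by apply: leq_trans N2q; rewrite muln_gt0 (ltnW q_gt1).
(* The surviving half, divided by 2 Q, is 2 d f: one d f absorbs the code and ln(f + 1), the other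
   is the decay. *)
pose d := eps * K / (8 * Q); have d_gt0 : 0 < d by rewrite divr_gt0 ?mulr_gt0.
pose c1 : R := (N + 2 + 2 * q + N * N)%:R.
have [e1 growth] := @ln_growth c1 lq d (ler0n _ _) d_gt0.
pose e0 := maxn e1 (q.+1 * (N * N + 2)).
pose C := (Q * (lb + (Q + 2) * la) + 4 * Q * lq) / (2 * Q).
exists d, C, (e0 * e0)%N; split=> // f m le_f x_gt0 far.
have [e /andP[lo hi]] := exists_sqrt f.
have le_e : (e0 <= e)%N.
  rewrite leqNgt; apply/negP => lt.
  by have := leq_trans (leq_mul lt lt) le_f; rewrite leqNgt hi.
have e1_le : (e1 <= e)%N by apply: leq_trans le_e; apply: leq_maxl.
have e2_le : (q.+1 * (N * N + 2) <= e)%N by apply: leq_trans le_e; apply: leq_maxr.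
have qe : (q < e)%N by apply: leq_trans e2_le; rewrite leq_pmulr // addn2.
have e_gt0 : (0 < e)%N by apply: leq_ltn_trans qe.
have [A] : exists A, A \in sample_mult q f m by apply/card_gt0P.
rewrite inE => /andP[As /asboolP Am].
have [AP lo_f] := sample_spec q_gt1 As Am.
have f_lt := spec_frob_lt AP; have m_gt0 := spec_gt0 AP; have m_le := spec_mult_le AP.
pose r := (f - q.-1 * m)%N.
have fE : f = (q.-1 * m + r)%N by rewrite /r subnKC.
have rm : (r < m)%N.
  move: f_lt; rewrite {1}fE -[X in (_ < X * m)%N](prednK (ltnW q_gt1)).
  by rewrite mulSnr ltn_add2l.
have qf : (q * q < f)%N by apply: leq_trans lo; apply: ltn_mul.
pose D := (f %/ N).+1; pose s := (q * (e + 2) + N * (N * e))%N.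
have sq : (e * e <= f < e.+1 * e.+1)%N by rewrite lo.
have [fND Dm ltN les] := window_parameters q_gt1 N2q e2_le sq f_lt m_le.
rewrite -/D -/s in fND Dm les.
have [T_gt0 lowT] := @ln_card_sample_ge q f q3 qf.
have up := @ln_card_sample_mult_le q f m r N e D s q_gt1 e_gt0 N_gt0 fND Dm ltN les rm fE x_gt0.
rewrite -/la -/lb -/lq -/Q in lowT up.
set lT := ln #|sample_space q f|%:R in lowT *.
set lx := ln #|sample_mult q f m|%:R in up *.
set lf := ln f.+1%:R in up *.
set code := (N * e).+1%:R * lf + s%:R * (ln m%:R + lq) in up.
have lm : ln m%:R <= lf by apply: ler_ln_nat => //; apply: leq_trans m_le _.
have lf_ge0 : 0 <= lf by apply: ln_nat_ge0.
have lf_le : lf <= 2 * ln e.+1%:R.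
  have : lf <= ln (e.+1 * e.+1)%:R by apply: ler_ln_nat.
  by rewrite ln_natM //; lra.
have code_le : code + lf <= d * f%:R.
  apply: (@le_trans _ _ (c1 * e.+1%:R * (2 * ln e.+1%:R + lq))); last first.
    apply: le_trans (growth e e1_le) _; rewrite ler_pM2l //.
    by rewrite -natrM ler_nat.
  apply: (@le_trans _ _ (((N * e).+2 + s)%:R * (lf + lq))).
    rewrite natrD -[(N * e).+2%:R]natr1 /code.
    have : s%:R * ln m%:R <= s%:R * lf by rewrite ler_wpM2l.
    have : 0 <= (N * e).+1%:R * lq by rewrite mulr_ge0.
    lra.
  apply: ler_pM => //; [by rewrite addr_ge0| |lra].
  by rewrite -natrM ler_nat code_exponent_le.
have NR : 0 < N%:R :> R by rewrite ltr0n.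
have fR : f%:R = Q * m%:R + r%:R :> R by rewrite {1}fE natrD natrM.
have DN : D%:R * N%:R <= f%:R + N%:R :> R.
  rewrite -natrM -natrD ler_nat /D mulSn addnC leq_add2r; exact: leq_trunc_div.
have far' : eps * f%:R <= r%:R by move: far; rewrite fR; lra.
have mf : m%:R <= f%:R :> R by rewrite ler_nat.
have q2E : q.+2%:R = Q + 3 :> R by rewrite -natr1 -natr1 qE; lra.
rewrite q2E in lowT.
have p1 : Q * ((m%:R + 2 * D%:R * N%:R) * lq) <= Q * ((3 * f%:R + 2 * N%:R) * lq).
  by rewrite ler_pM2l // ler_wpM2r //; lra.
have p2 : N%:R * (K * (eps * f%:R)) <= N%:R * (K * r%:R) by rewrite ler_pM2l // ler_pM2l.
have p3 : 12 * Q * lq * f%:R <= N%:R * (eps * K) * f%:R by rewrite ler_wpM2r.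
have up' := ler_wpM2l (ltW Q_gt0) up.
have lowT' := ler_wpM2l (ltW NR) lowT.
(* Combines Q times the upper bound with N times the lower bound, after substituting f = Q m + r. *)
have main : N%:R * (2 * Q * (lx - lT)) <=
    N%:R * (2 * Q * code - (eps * K * f%:R) / 2 + (Q * (lb + (Q + 2) * la) + 4 * Q * lq)).
  rewrite fR in lowT'. rewrite fR in p1 p2 p3 *. rewrite /K qE in p2 p3 *. lra.
rewrite ler_pM2l // in main.
have dE : d * (8 * Q) = eps * K by rewrite /d divfK // mulf_neq0 // gt_eqF.
have CE : C * (2 * Q) = Q * (lb + (Q + 2) * la) + 4 * Q * lq.
  by rewrite /C divfK // mulf_neq0 // gt_eqF.
have code' := ler_wpM2l (ltW Q_gt0) code_le.
rewrite -CE -dE in main.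
rewrite -(ler_pM2l Q_gt0); lra.
Qed.

Lemma card_bad_le (q : nat) eps eta : (3 <= q)%N -> 0 < eps -> 0 < eta ->
  exists n0, forall f, (n0 <= f)%N -> (0 < #|sample_space q f|)%N /\
    #|sample_space q f :\: good_event q eps f|%:R <= eta * #|sample_space q f|%:R.
Proof.
move=> hq heps eta_gt0; have [c [C [n0 [c_gt0 expo]]]] := sample_mult_exponent_lt hq heps.
(* From here on C - c f <= ln eta. *)
pose n1 := (Num.truncn ((C - ln eta) / c)).+1.
exists (maxn (maxn n0 n1) (q * q).+1) => f; rewrite !geq_max => /andP[/andP[n0f n1f] qf].
have [T_gt0 _] := @ln_card_sample_ge q f hq qf.
have q_gt1 : (1 < q)%N by lia.
have etaf : C - c * f%:R <= ln eta.
  have : (C - ln eta) / c <= f%:R.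
    by apply/ltW/(lt_le_trans (truncnS_gt _)); rewrite ler_nat.
  by rewrite ler_pdivrMr // [f%:R * c]mulrC; lra.
pose far (m : nat) := eps * f%:R <= f%:R - q.-1%:R * m%:R.
pose B (m : 'I_f.+1) := if far m then sample_mult q f m else finset.set0.
(* Each of the f + 1 possible multiplicities receives an equal share of the allowed error. *)
have cB m : #|B m|%:R <= eta * #|sample_space q f|%:R / f.+1%:R.
  rewrite ler_pdivlMr // /B; case: ifP => [fm|_]; last first.
    by rewrite cards0 mul0r mulr_ge0 // ltW.
  have [x0|x_gt0] := posnP #|sample_mult q f m|; first by rewrite x0 mul0r mulr_ge0 // ltW.
  rewrite -ler_ln ?posrE ?mulr_gt0 ?ltr0n // !lnM ?posrE ?ltr0n //.
  by have := expo f m n0f x_gt0 fm; lra.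
have cover : sample_space q f :\: good_event q eps f \subset \bigcup_m B m.
  apply/fintype.subsetP => A; rewrite finset.in_setD => /andP[notg As].
  have [_ [_ [_ [m [_ [Am _]]]]]] : is_numerical_semigroup (sg_of A) /\
      has_frobenius (sg_of A) f /\ has_depth (sg_of A) q.
    by move: As; rewrite inE => /asboolP.
  have [AP lo_f] := sample_spec q_gt1 As Am.
  have mf : (m < f.+1)%N by rewrite ltnS; apply: spec_mult_le AP.
  apply/finset.bigcupP; exists (Ordinal mf) => //; rewrite /B ifT.
    by rewrite inE As /=; apply/asboolP.
  rewrite /far /= leNgt; apply: contra notg => near_m.
  rewrite inE As /=; apply/asboolP; exists m; split => //.
  have -> : (q%:R : R) - 1 = q.-1%:R by rewrite -subn1 natrB //; lia.
  by rewrite ger0_norm // subr_ge0 -natrM ler_nat.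
split=> //.
apply: (@le_trans _ _ (\sum_m #|B m|)%:R).
  by rewrite ler_nat (leq_trans (subset_leq_card cover)) // leq_card_bigcup.
rewrite natr_sum; apply: le_trans (ler_sum _ (fun m _ => cB m)) _.
rewrite sumr_const card_ord; set z := (X in X *+ _ <= _).
by rewrite -(mulr_natr z) /z divfK // pnatr_eq0.
Qed.

End Asymptotics.

Local Open Scope classical_set_scope.

Theorem theorem5p4 (R : realType) (q : nat) (hq : (3 <= q)%N)
  (eps : R) (heps : 0 < eps) :
  (fun f : nat => prob_good q eps f : R) @ \oo --> (1 : R).
Proof.
apply/cvgrPdist_le => eta eta_gt0.
have [n0 bad_le] := card_bad_le hq heps eta_gt0.
exists n0 => // f /= /bad_le[T_gt0 {}bad_le].
have sub_good : good_event q eps f \subset sample_space q f.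
  by apply/fintype.subsetP => A; rewrite inE => /andP[].
have TR : 0 < #|sample_space q f|%:R :> R by rewrite ltr0n.
rewrite /prob_good ger0_norm.
  rewrite -[X in X - _](divff (lt0r_neq0 TR)) -mulrBl ler_pdivrMr //.
  rewrite -natrB ?subset_leq_card // -[in X in (_ - X)%N](finset.setIidPr sub_good) -cardsD.
  exact: bad_le.
by rewrite subr_ge0 ler_pdivrMr // mul1r ler_nat subset_leq_card.
Qed.
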